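(* Let $\mathcal{A}_1,\dots,\mathcal{A}_M$ be the partition of $[0,1]^d$ into $M=K^d$ grid cells used in the Grid-Bandit Active Learning algorithm, with index sets $\mathcal{M}_{\mathrm{dense}}$ and $\mathcal{M}_{\mathrm{sparse}}$, and assume that $$\Delta:=\min_{m\in\mathcal{M}_{\mathrm{dense}}}\Pr(Y=1\mid\bm{x}\in\mathcal{A}_m)-\max_{m\in\mathcal{M}_{\mathrm{sparse}}}\Pr(Y=1\mid\bm{x}\in\mathcal{A}_m)>0.$$ Run the algorithm with $T_{\mathrm{train}}$ rounds, threshold $$\tau=\frac12\Bigl(\min_{m\in\mathcal{M}_{\mathrm{dense}}}\Pr(Y=1\mid\bm{x}\in\mathcal{A}_m)+\max_{m\in\mathcal{M}_{\mathrm{sparse}}}\Pr(Y=1\mid\bm{x}\in\mathcal{A}_m)\Bigr),$$ and warm-up proportion $\nu\in(0,1)$ satisfying $\nu>(32\log T_{\mathrm{train}}/\Delta^2+1)/T_{\mathrm{train}}$. Let $\mathscr{A}(t)=\{S(t)\neq\mathcal{M}_{\mathrm{dense}}\}$, where $S(t)$ is the set of grid cells selected by the algorithm at round $t$. Then the expected proportion of rounds with mis-selected cells satisfies $$\mathbb{E}\Bigl\{\frac1{T_{\mathrm{train}}}\sum_{t=1}^{T_{\mathrm{train}}}\mathbb{I}(\mathscr{A}(t))\Bigr\}\le\nu+\frac{M}{T_{\mathrm{train}}}\Bigl(1+\frac{16}{\Delta^2}\Bigr).$$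
   Context: Setting: for $\bm{x}\in[0,1]^d$ the response $Y\in\{0,1\}$ is Bernoulli with success probability $\Pr(Y=1\mid\bm{x})$ (measurable in $\bm{x}$). For $p_R\in(0,1)$, $\mathcal{X}_R=\{\bm{x}\in[0,1]^d:\Pr(Y=1\mid\bm{x})\ge p_R\}$, assumed (together with its complement) to have positive Lebesgue measure, with $\{\bm{x}:\Pr(Y=1\mid\bm{x})=p_R\}$ Lebesgue-null. For a width $w>0$, $\mathcal{T}_w(\partial\mathcal{X}_R)$ denotes the tubular neighborhood of width $w$ of the boundary of $\mathcal{X}_R$; put $\mathcal{S}_{\mathrm{dense}}=\mathcal{X}_R\cup\mathcal{T}_w(\partial\mathcal{X}_R)$ and let $\mathcal{S}_{\mathrm{sparse}}$ be its complement in $[0,1]^d$. $\mathcal{M}_{\mathrm{sparse}}\subseteq\{1,\dots,M\}$ is the set of indices of all cells fully contained in $\mathcal{S}_{\mathrm{sparse}}$, and $\mathcal{M}_{\mathrm{dense}}=\{1,\dots,M\}\setminus\mathcal{M}_{\mathrm{sparse}}$ (both nonempty, so that $\Delta$ is defined). $\Pr(Y=1\mid\bm{x}\in\mathcal{A}_m)$ is the success probability when $\bm{x}$ is uniform on $\mathcal{A}_m$. Grid-Bandit Active Learning algorithm (inputs: number of rounds $T_{\mathrm{train}}$, grid division constant $K$, threshold $\tau$, warm-up proportion $\nu$). Partition $[0,1]^d$ into $M=K^d$ disjoint grid cells $\mathcal{A}_1,\dots,\mathcal{A}_M$ and set $T_{\mathrm{warm}}=\lfloor\nu T_{\mathrm{train}}\rfloor$.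 For every cell $m$ keep parameters $\alpha_m,\beta_m$, both initialized to $1$. Observing cell $m$ means: draw a new point $\bm{x}$ uniformly from $\mathcal{A}_m$ (independently of the past), observe the response $y\in\{0,1\}$ at $\bm{x}$ (conditionally independent of the past given $\bm{x}$), and increase $\alpha_m$ by $1$ if $y=1$ and $\beta_m$ by $1$ if $y=0$. - Warm-up rounds $t=1,\dots,T_{\mathrm{warm}}$: observe every cell $m=1,\dots,M$ once (so all cells are selected). - Rounds $t=T_{\mathrm{warm}}+1,\dots,T_{\mathrm{train}}$: for each $m=1,\dots,M$ sample independently $\tilde\theta_m(t)\sim\mathrm{Beta}(\alpha_m,\beta_m)$ with the current parameters; let $S(t)=\{m:\tilde\theta_m(t)\ge\tau\}$; if $S(t)=\emptyset$, regenerate all $\tilde\theta_m(t)$ until $S(t)\ne\emptyset$. Then observe each cell in $S(t)$ once; parameters of cells not in $S(t)$ are unchanged. *)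

(* Defs.v *)
From HB Require Import structures.
From mathcomp Require Import all_boot all_order all_algebra.
From mathcomp Require Import all_classical all_reals all_analysis.

Set Implicit Arguments.
Unset Strict Implicit.
Unset Printing Implicit Defensive.

Import Order.TTheory GRing.Theory Num.Theory.
Import numFieldNormedType.Exports.

Local Open Scope classical_set_scope.
Local Open Scope ring_scope.

Section LebesgueTuple.
Variable R : realType.

Definition tcons n (p : n.-tuple R * R) : n.+1.-tuple R :=
  [tuple of p.2 :: p.1].

Lemma measurable_tcons n : measurable_fun [set: n.-tuple R * R] (@tcons n).
Proof. exact: measurable_cons. Qed.

(* The image under [tcons] of the product of m with Lebesgue measure on R. *)
Definition lebT_step n (m : {measure set (n.-tuple R) -> \bar R}) :
    {measure set (n.+1.-tuple R) -> \bar R} :=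
  measure_function_pushforward__canonical__measure_function_Measure
    (m \x @lebesgue_measure R)%E (@measurable_tcons n).

(* Lebesgue measure on R^d, on the product sigma-algebra of d.-tuple R: the
   d-fold product of the one-dimensional one, the empty product being the unit
   mass on the one-point space R^0. *)
Fixpoint lebT d : {measure set (d.-tuple R) -> \bar R} :=
  if d is d'.+1 then lebT_step (lebT d') else \d_([tuple] : 0.-tuple R).

Definition unit_cube d : set (d.-tuple R) :=
  [set x | forall i, 0 <= tnth x i <= 1].

(* Mean of g under the uniform distribution on A. *)
Definition unif_mean d (A : set (d.-tuple R)) (g : d.-tuple R -> R) : R :=
  (\int[lebT d]_(x in A) g x) / fine (lebT d A).

End LebesgueTuple.

Section Regions.
Variables (R : realType) (d : nat).
Implicit Types (A : set (d.-tuple R)) (w : R).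

(* The topology of R^d is taken from row vectors, d.-tuple R carrying none. *)
Definition row_of (x : d.-tuple R) : 'rV[R]_d := \row_i tnth x i.

Definition boundary A : set 'rV[R]_d :=
  closure (row_of @` A) `\` (row_of @` A)°.

(* The norm of the library on 'rV is the sup norm. *)
Definition edist (u v : 'rV[R]_d) : R :=
  Num.sqrt (\sum_i (u ord0 i - v ord0 i) ^+ 2).

Definition tube w A : set (d.-tuple R) :=
  [set x | unit_cube x /\ exists2 z, boundary A z & edist (row_of x) z < w].

(* f x stands for Pr(Y = 1 | x). *)
Variables (f : d.-tuple R -> R) (pR w : R).

Definition X_R : set (d.-tuple R) := [set x | unit_cube x /\ pR <= f x].

Definition S_dense : set (d.-tuple R) := X_R `|` tube w X_R.

Definition S_sparse : set (d.-tuple R) := @unit_cube R d `\` S_dense.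

End Regions.

Section Grid.
Variables (R : realType) (d K : nat).

(* Multi-index of a cell; there are K ^ d of them. *)
Definition cell := {ffun 'I_d -> 'I_K}.

(* Cells are half-open, except along the upper faces of the cube, so that they
   are pairwise disjoint and cover [0,1]^d. *)
Definition grid_cell (c : cell) : set (d.-tuple R) :=
  [set x | forall i, (c i)%:R / K%:R <= tnth x i /\
     if (c i).+1 == K then tnth x i <= 1 else tnth x i < (c i).+1%:R / K%:R].

Variables (f : d.-tuple R -> R) (pR w : R).

Definition M_sparse : {set cell} :=
  [set c | `[< grid_cell c `<=` S_sparse f pR w >]]%SET.

Definition M_dense : {set cell} := (~: M_sparse)%SET.

Definition cell_prob (c : cell) : R := unif_mean (grid_cell c) f.

(* Minimum and maximum over finite nonempty sets of probabilities, for which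
   the default values 1 and 0 are neutral. *)
Definition min_dense : R := \big[Num.min/1]_(c in M_dense) cell_prob c.
Definition max_sparse : R := \big[Num.max/0]_(c in M_sparse) cell_prob c.

Definition gap : R := min_dense - max_sparse.
Definition midpoint : R := (min_dense + max_sparse) / 2.

(* Pr(x \in B, Y = b) when x is uniform on the cell c and, given x, Y is
   Bernoulli with success probability f x. *)
Definition obs_law (c : cell) (B : set (d.-tuple R)) (b : bool) : R :=
  unif_mean (grid_cell c) (fun x => \1_B x * bernoulli_pmf (f x) b).

End Grid.

Section Run.
Context (R : realType) (d K : nat) (dO : measure_display)
  (Omega : measurableType dO).

Local Notation cell := (cell d K).

(* [theta t k c]: k-th draw (from k = 0) of the sample of cell c at round t.
   [point t c], [resp t c]: point drawn in cell c at round t, and response.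
   Only the entries which the algorithm reaches are meaningful: [theta t k] if
   the draws j < k at round t selected nothing, and [point t c], [resp t c] if
   c is selected at round t. The other entries are left unconstrained. *)
Record trace := Trace {
  theta : nat -> nat -> cell -> Omega -> R;
  point : nat -> cell -> Omega -> d.-tuple R;
  resp : nat -> cell -> Omega -> bool }.

Variables (Twarm : nat) (tau : R) (z : trace).

Definition proposal t k (o : Omega) : {set cell} :=
  [set c | tau <= theta z t k c o]%SET.

(* S(t). The value set0 when every draw fails is a mere convention, for an
   event which turns out to be negligible. *)
Definition selected t (o : Omega) : {set cell} :=
  if (t <= Twarm)%N then [set: cell]%SET
  else if pselect (exists k, proposal t k o != finset.set0) is left ex
       then proposal t (ex_minn ex) o else finset.set0.

(* Values of the parameters when round t starts, rounds being numbered from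
   1. *)
Definition alpha t c (o : Omega) : nat :=
  (1 + \sum_(1 <= s < t) ((c \in selected s o) && resp z s c o))%N.

Definition beta t c (o : Omega) : nat :=
  (1 + \sum_(1 <= s < t) ((c \in selected s o) && ~~ resp z s c o))%N.

(* The k-th draw takes place at round t. *)
Definition reached t k : set Omega :=
  [set o | (Twarm < t)%N /\ forall j, (j < k)%N ->
     proposal t j o = finset.set0].

Definition draw_events t k : set (set Omega) :=
  [set E | exists c B, measurable B /\
     E = reached t k `&` [set o | B (theta z t k c o)]].

Definition obs_events t : set (set Omega) :=
  [set E | exists c B b, measurable B /\
     E = [set o | c \in selected t o /\ B (point z t c o) /\
                  resp z t c o = b]].

(* All that has been seen in the rounds 1, ..., t - 1. *)
Definition round_past t : set (set Omega) :=
  [set E | exists s, (0 < s < t)%N /\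
     (obs_events s E \/ exists k, draw_events s k E)].

Definition draw_past t k : set (set Omega) :=
  <<s round_past t `|` [set E | exists j, (j < k)%N /\ draw_events t j E] >>.

Definition obs_past t : set (set Omega) :=
  <<s round_past t `|` [set E | exists j, draw_events t j E] >>.

(* z is a run of the algorithm on the probability space (Omega, P): each new
   batch of random variables has the prescribed law conditionally on the past,
   conditional laws being expressed through the events E of the past. *)
Record is_run (P : probability Omega R) (f : d.-tuple R -> R) (T : nat) :
    Prop := IsRun {
  measurable_theta : forall t k c, measurable_fun [set: Omega] (theta z t k c);
  measurable_point : forall t c, measurable_fun [set: Omega] (point z t c);
  measurable_resp : forall t c, measurable_fun [set: Omega] (resp z t c);
  draw_law : forall t k (E : set Omega) (a b : cell -> nat)
      (B : cell -> set R),
    (Twarm < t <= T)%N -> draw_past t k E -> (forall c, measurable (B c)) ->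
    let E' := E `&` reached t k `&`
      [set o | forall c, alpha t c o = a c /\ beta t c o = b c] in
    P (E' `&` [set o | forall c, B c (theta z t k c o)]) =
    (P E' * (\prod_c fine (beta_prob (a c) (b c) (B c)))%:E)%E;
  point_resp_law : forall t (E : set Omega) (D : {set cell})
      (B : cell -> set (d.-tuple R)) (y : cell -> bool),
    (0 < t <= T)%N -> obs_past t E -> (forall c, measurable (B c)) ->
    let E' := E `&` [set o | selected t o = D] in
    P (E' `&` [set o | forall c, c \in D ->
                 B c (point z t c o) /\ resp z t c o = y c]) =
    (P E' * (\prod_(c in D) obs_law f c (B c) (y c))%:E)%E }.

End Run.

(* Main.v *)
Require Import Defs.
From mathcomp Require Import all_boot all_order all_algebra ring lra.
From mathcomp Require Import all_classical all_reals all_analysis.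
From mathcomp Require Import measurable_realfun.

Import Order.TTheory GRing.Theory Num.Theory.
Import numFieldNormedType.Exports.

Local Open Scope classical_set_scope.
Local Open Scope ring_scope.

(** Only the first proposal of a round matters.  The set of dense cells is
nonempty, so if the first proposal of a round after the warm-up is that set,
then it is not regenerated and the selection is correct.  A wrong selection
therefore forces the first draw of some cell to fall on the wrong side of the
threshold tau: below tau for a dense cell, at or above tau for a sparse one.
By a union bound it is enough to show that each such draw has probability at
most 1/T; the warm-up rounds cost at most nu and the others at most M/T.

For one cell, both sources of error are handled by a single exponential
weight.  Take a sparse cell, with success probability mu <= tau - Delta/2,
after i successes and j failures.  The tail at tau of Beta(i + 1, j + 1) is a
lower binomial tail, since the derivative of a binomial distribution function
in its parameter is minus a Beta density ([beta_prob_ge]); Chernoff's method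
bounds it, for every x >= 1, by x^i q^(i + j + 1) with q = 1 - tau + tau / x
([beta_prob_ge_le]).  The latter is an exponential weight of the counts, hence
easy to average over the data: an observation of the cell multiplies it by
x q with probability mu and by q otherwise, on average by
(1 - tau + tau / x)(1 + mu (x - 1)), which for x = 1 + Delta is at most
1 - Delta^2 / 8 ([chernoff_rate]).  The weight is thus a supermartingale
whatever the adaptive selection does, and it contracts by 1 - Delta^2 / 8 in
each warm-up round, where the cell is observed for sure.  Going back from
round t to round 1 ([prob_theta_decay]) gives that the draw is wrong with
probability at most (1 - Delta^2 / 8)^Twarm, and the lower bound on nu makes
this at most 1/T ([warm_up_suffices]).  Dense cells are symmetric under the
exchange of successes and failures. *)

Set Implicit Arguments.
Unset Strict Implicit.
Unset Printing Implicit Defensive.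

(** * Tails of Beta distributions with integer parameters *)

(** The polynomial in t giving Pr(Bin(n, t) <= k).  Having a polynomial, and
not just a function of t, gives access to formal derivatives. *)
Definition binom_lower {R : nzRingType} (n k : nat) : {poly R} :=
  \sum_(i < k.+1) ('X^i * (1 - 'X) ^+ (n - i)) *+ 'C(n, i).

(** The terms of the differentiated sum cancel two by two, only the last one
being left. *)
Lemma deriv_binom_lower (R : comNzRingType) n k : (k <= n)%N ->
  (binom_lower n.+1 k)^`() =
  - (('X^k * (1 - 'X) ^+ (n - k)) *+ (n.+1 * 'C(n, k))) :> {poly R}.
Proof.
have dX m : ((1 - 'X : {poly R}) ^+ m)^`() = - ((1 - 'X) ^+ m.-1 *+ m).
  by rewrite deriv_exp derivB derivC derivX sub0r mulNr mul1r mulNrn.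
rewrite /binom_lower; elim: k => [_|k IH kn].
  by rewrite big_ord1 expr0 mul1r !subn0 !bin0 mulr1n muln1 mul1r dX.
rewrite big_ord_recr derivD IH 1?ltnW//= subSS derivMn derivM derivXn dX.
rewrite -subnS mulrN mulrnBl -!(mulrnAr, mulrnAl) !(mulrnAr, mulrnAl) -!mulrnA.
by rewrite -mul_bin_diag -[X in (X - k)%N]/(n.+1.-1) -subSS -mul_bin_down addKr.
Qed.

Section BetaTail.
Variable R : realType.
Implicit Types (t x : R) (a b : nat).

Lemma horner_binom_lower n k t : (binom_lower n k).[t] =
  \sum_(i < k.+1) (t ^+ i * (1 - t) ^+ (n - i)) *+ 'C(n, i).
Proof.
rewrite /binom_lower horner_sum; apply: eq_bigr => i _.
by rewrite -mulr_natr hornerM -[_%:R]polyC_natr hornerC hornerM !horner_exp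
  !hornerE mulr_natr.
Qed.

Lemma binom_lower1 a b : (binom_lower (a + b).+1 a).[1] = 0 :> R.
Proof.
rewrite horner_binom_lower big1// => i _.
have ia : (i <= a)%N by rewrite -ltnS.
by rewrite subrr -addnS addnC -addnBA// addSn expr0n mulr0 mul0rn.
Qed.

(** A tail of Beta(a + 1, b + 1) is the probability of at most a successes in
a + b + 1 trials: as functions of t they have the same derivative, by
[deriv_binom_lower], and both vanish at t = 1. *)
Lemma beta_prob_ge a b t : 0 <= t <= 1 ->
  beta_prob a.+1 b.+1 `[t, +oo[ = ((binom_lower (a + b).+1 a).[t])%:E.
Proof.
move=> /andP[t0 t1].
rewrite -integral_beta_pdf//.
(* The inverse of the Beta function at (a + 1, b + 1). *)
pose c := (a + b).+1`!%:R / (a`! * b`!)%:R : R.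
transitivity (\int[lebesgue_measure]_(x in `[t, 1%R]) (c * XMonemX a b x)%:E)%E.
  rewrite [LHS]integral_mkcond [RHS]integral_mkcond; apply: eq_integral => x _.
  rewrite !patchE /beta_pdf patchE !mem_setE !in_itv/=.
  case: (leP t x) => //= tx.
  rewrite (le_trans t0 tx)/=; case: (leP x 1) => _; last by rewrite mul0r.
  by rewrite beta_fun_fact invf_div mulrC.
move: t1; rewrite le_eqVlt => /predU1P[->|t1].
  by rewrite set_itv1 integral_set1 binom_lower1.
rewrite (@continuous_FTC2 _ _ (fun x => - (binom_lower (a + b).+1 a).[x]))//.
- by rewrite binom_lower1 oppr0 sub0e -EFinN opprK.
- apply: continuous_subspaceT => x; apply: cvgM; first exact: cvg_cst.
  exact: continuous_XMonemX.
- split=> [x _| |]; first exact/derivableN/derivable_horner.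
  + by apply: cvg_at_right_filter; apply: cvgN; exact: continuous_horner.
  + by apply: cvg_at_left_filter; apply: cvgN; exact: continuous_horner.
- have cE : ((a + b).+1 * 'C(a + b, a))%:R = c.
    have nz : (a`! * b`!)%:R != 0 :> R by rewrite pnatr_eq0 -lt0n muln_gt0
      !fact_gt0.
    apply: (mulIf nz); rewrite /c divfK// -natrM -mulnA; congr _%:R.
    by rewrite factS -[in RHS](bin_fact (leq_addr b a)) addKn.
  move=> x _; rewrite derive1N; last exact: derivable_horner.
  rewrite -derivE deriv_binom_lower ?leq_addr// hornerN opprK addKn.
  rewrite -mulr_natl hornerM -[_%:R]polyC_natr cE hornerC hornerM !horner_exp
    !hornerE.
  by [].
Qed.

(** Chernoff's method: each term of the sum is multiplied by x^(k - i) >= 1,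
and the extended sum is then given by the binomial formula. *)
Lemma binom_lower_le n k t x : 0 <= t <= 1 -> 1 <= x -> (k <= n)%N ->
  (binom_lower n k).[t] <= x ^+ k * (1 - t + t / x) ^+ n.
Proof.
move=> /andP[t0 t1] x1 kn; have x0 : 0 < x by exact: lt_le_trans x1.
rewrite horner_binom_lower exprDn mulr_sumr.
rewrite (big_ord_widen n.+1
  (fun i => (t ^+ i * (1 - t) ^+ (n - i)) *+ 'C(n, i)))//=.
rewrite [leRHS](bigID (fun i : 'I_n.+1 => (i < k.+1)%N))/= -[leLHS]addr0.
have t1' : 0 <= 1 - t by rewrite subr_ge0.
apply: lerD; last first.
  apply: sumr_ge0 => i _; rewrite mulr_ge0 ?exprn_ge0// ?(ltW x0)//.
  by rewrite mulrn_wge0// mulr_ge0// exprn_ge0// divr_ge0// ltW.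
apply: ler_sum => i; rewrite ltnS => ik.
rewrite mulrnAr lerMn2r; apply/orP; right.
rewrite mulrC mulrCA ler_wpM2l ?exprn_ge0//.
rewrite expr_div_n mulrCA ler_peMr ?exprn_ge0//.
by rewrite ler_pdivlMr ?exprn_gt0// mul1r ler_weXn2l.
Qed.

(** The same for more than k successes, that is, at most n - k - 1 failures,
so the term of i successes is multiplied by x^(i - k - 1) >= 1. *)
Lemma binom_upper_le n k t x : 0 <= t <= 1 -> 1 <= x -> (k < n)%N ->
  1 - (binom_lower n k).[t] <= x ^+ (n - k.+1) * (t + (1 - t) / x) ^+ n.
Proof.
move=> /andP[t0 t1] x1 kn; have x0 : 0 < x by exact: lt_le_trans x1.
have t1' : 0 <= 1 - t by rewrite subr_ge0.
have e : 1 = \sum_(i < n.+1) ((1 - t) ^+ (n - i) * t ^+ i) *+ 'C(n, i).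
  by rewrite -exprDn subrK expr1n.
rewrite horner_binom_lower [t + _]addrC !exprDn mulr_sumr {1}e.
rewrite (big_ord_widen n.+1
  (fun i => (t ^+ i * (1 - t) ^+ (n - i)) *+ 'C(n, i)))//=; last exact: ltnW.
rewrite (bigID (fun i : 'I_n.+1 => (i < k.+1)%N))/= addrAC.
under eq_bigr do rewrite mulrC.
rewrite subrr add0r -[leLHS]add0r.
rewrite [leRHS](bigID (fun i : 'I_n.+1 => (i < k.+1)%N))/=.
apply: lerD.
  apply: sumr_ge0 => i _; rewrite mulr_ge0 ?exprn_ge0// ?(ltW x0)//.
  by rewrite mulrn_wge0// mulr_ge0// exprn_ge0// divr_ge0// ltW.
apply: ler_sum => i; rewrite -leqNgt => ki.
rewrite mulrnAr lerMn2r; apply/orP; right.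
rewrite mulrA ler_wpM2r ?exprn_ge0//.
rewrite expr_div_n mulrCA ler_peMr ?exprn_ge0//.
by rewrite ler_pdivlMr ?exprn_gt0// mul1r ler_weXn2l// leq_sub2l.
Qed.

Lemma beta_prob_ge_le a b t x : 0 <= t <= 1 -> 1 <= x ->
  (beta_prob a.+1 b.+1 `[t, +oo[ <=
    (x ^+ a * (1 - t + t / x) ^+ (a + b).+1)%:E)%E.
Proof.
by move=> t01 x1; rewrite beta_prob_ge// lee_fin binom_lower_le// ltnW//
  ltnS leq_addr.
Qed.

Lemma beta_prob_lt_le a b t x : 0 <= t <= 1 -> 1 <= x ->
  (beta_prob a.+1 b.+1 `]-oo, t[ <=
    (x ^+ b * (t + (1 - t) / x) ^+ (a + b).+1)%:E)%E.
Proof.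
move=> t01 x1.
have -> : `]-oo, t[%classic = ~` `[t, +oo[%classic :> set R.
  by rewrite setCitvr.
rewrite probability_setC// [X in (_ - X <= _)%E](beta_prob_ge _ _ t01)
  -EFinB lee_fin.
by have := @binom_upper_le (a + b).+1 a t x t01 x1; rewrite subSS addKn; apply;
  rewrite ltnS leq_addr.
Qed.

End BetaTail.

(** * Numerical estimates *)

Section Numeric.
Variable R : realType.

(** The average growth factor of the weight of a cell observed once.  The
choice x = 1 + Delta is not optimal, but gives a polynomial inequality, which
follows from mu (1 - t) <= t (1 - t) <= 1/4. *)
Lemma chernoff_rate (Delta mu t : R) : 0 < Delta <= 1 -> 0 <= mu -> t <= 1 ->
  mu + Delta / 2 <= t ->
  (1 - t + t / (1 + Delta)) * (1 + mu * Delta) <= 1 - Delta ^+ 2 / 8.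
Proof.
move=> /andP[D0 D1] m0 t1 mt.
have D1' : 0 < 1 + Delta by lra.
have -> : (1 - t + t / (1 + Delta)) * (1 + mu * Delta) =
   (1 + Delta - Delta * t) * (1 + mu * Delta) / (1 + Delta).
  by field; lra.
rewrite ler_pdivrMr//.
have h : mu * (1 - t) <= 1 / 4.
  have := mulr_ge0 (_ : 0 <= 1 - t) (_ : 0 <= t - mu); rewrite !subr_ge0.
  move=> /(_ t1) /(_ _) h1; have := sqr_ge0 (1 - 2 * t).
  have : mu <= t by lra.
  move=> /h1; nra.
have := ler_wpM2l (ltW D0) mt. have := ler_wpM2l (exprn_ge0 2 (ltW D0)) h.
nra.
Qed.

(** The warm-up lasts at least 32 ln T / Delta^2 rounds, and
1 - Delta^2 / 8 <= exp (- Delta^2 / 8): the left-hand side is even at most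
T^-4. *)
Lemma warm_up_suffices (Delta nu : R) (T : nat) : 0 < Delta <= 1 -> (0 < T)%N ->
  nu > (32 * ln T%:R / Delta ^+ 2 + 1) / T%:R ->
  (1 - Delta ^+ 2 / 8) ^+ (Num.truncn (nu * T%:R)) <= T%:R^-1.
Proof.
move=> /andP[D0 D1] T0 hnu; set n := Num.truncn _.
have T0' : 0 < T%:R :> R by rewrite ltr0n.
have lnT : 0 <= ln T%:R :> R by rewrite ln_ge0// ler1n.
have nuT : 32 * ln T%:R / Delta ^+ 2 + 1 < nu * T%:R.
  by rewrite -ltr_pdivrMr.
have nuT0 : 0 <= nu * T%:R.
  by rewrite (le_trans _ (ltW nuT))// addr_ge0//
    divr_ge0 ?exprn_ge0 ?mulr_ge0// ltW.
have nlow : 32 * ln T%:R / Delta ^+ 2 < n%:R.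
  have /andP[_] := truncn_itv nuT0; rewrite -/n -natr1 => h.
  by rewrite -(ltrD2r 1) (lt_trans nuT).
rewrite ltr_pdivrMr ?exprn_gt0// in nlow.
rewrite -[leRHS]lnK ?posrE ?invr_gt0// lnV ?posrE//.
apply: (@le_trans _ _ (expR (- (Delta ^+ 2 / 8)) ^+ n)); last first.
  rewrite -expRM_natl ler_expR; lra.
apply: lerXn2r; rewrite ?nnegrE ?expR_ge0//; last exact: expR_ge1Dx.
by nra.
Qed.

End Numeric.

(** * Law of one response *)

Section ObsLaw.
Variables (R : realType) (d K : nat) (f : d.-tuple R -> R).
Hypothesis K0 : (0 < K)%N.
Hypothesis mf : measurable_fun (@unit_cube R d) f.
Hypothesis f01 : forall x, @unit_cube R d x -> 0 <= f x <= 1.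
Implicit Type c : cell d K.

Lemma grid_cell_sub_cube c : @grid_cell R d K c `<=` @unit_cube R d.
Proof.
move=> x cx i; have [ge0 le1] := cx i.
rewrite (le_trans _ ge0) ?divr_ge0//=.
case: ifPn le1 => // _ /ltW /le_trans; apply.
by rewrite ler_pdivrMr ?ltr0n// mul1r ler_nat ltn_ord.
Qed.

Lemma measurable_box (J : 'I_d -> set R) : (forall i, measurable (J i)) ->
  measurable [set x : d.-tuple R | forall i, J i (tnth x i)].
Proof.
move=> mJ; have -> : [set x : d.-tuple R | forall i, J i (tnth x i)] =
    \bigcap_(i in [set: 'I_d]) ((fun x => tnth x i) @^-1` J i).
  by apply/seteqP; split=> x Jx i => [_|]; [exact: Jx|exact: (Jx i I)].
apply: fin_bigcap_measurable => // i _.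
by rewrite -[X in measurable X]setTI; exact: (@measurable_tnth _ R d i).
Qed.

Lemma measurable_unit_cube : measurable (@unit_cube R d).
Proof.
have := @measurable_box (fun=> `[0, 1]%classic) (fun=> measurable_itv _).
by rewrite (_ : [set x | _] = @unit_cube R d).
Qed.

Lemma measurable_grid_cell c : measurable (@grid_cell R d K c).
Proof.
have := @measurable_box (fun i => `[(c i)%:R / K%:R, +oo[%classic `&`
  if (c i).+1 == K then `]-oo, 1]%classic
  else `]-oo, (c i).+1%:R / K%:R[%classic) _.
rewrite (_ : [set x | _] = @grid_cell R d K c).
  by apply=> i; apply: measurableI => //; case: ifP.
by apply/seteqP; split=> x xi i; have := xi i;
  rewrite /= in_itv/= andbT => -[->]; case: ifP; rewrite /= in_itv.
Qed.

(** The last bound is an equality for a cell of positive finite volume; were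
the volume 0 or infinite, means over the cell would be 0 by convention, and the
inequality still hold. *)
Lemma obs_law_bounds c :
  [/\ obs_law f c setT true = cell_prob f c,
      0 <= cell_prob f c,
      0 <= obs_law f c setT false &
      cell_prob f c + obs_law f c setT false <= 1].
Proof.
have mA := measurable_grid_cell c.
have cf01 x : @grid_cell R d K c x -> 0 <= f x <= 1.
  by move=> /grid_cell_sub_cube; exact: f01.
have p1E : obs_law f c setT true = cell_prob f c.
  rewrite /obs_law /cell_prob /unif_mean; congr (_ / _).
  by apply: eq_Rintegral => x _; rewrite indicT mul1r.
have p0E : obs_law f c setT false = unif_mean (@grid_cell R d K c)
    (fun x => 1 - f x).
  rewrite /obs_law /unif_mean; congr (_ / _).
  by apply: eq_Rintegral => x _; rewrite indicT mul1r.
have v0 : 0 <= fine (lebT R d (@grid_cell R d K c)) by exact: fine_ge0.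
split=> //.
- by rewrite divr_ge0// Rintegral_ge0// => x /cf01 /andP[].
- rewrite p0E divr_ge0// Rintegral_ge0// => x /cf01 /andP[_].
  by rewrite subr_ge0.
rewrite p0E /cell_prob /unif_mean -mulrDl.
have [->|vnz] := eqVneq (fine (lebT R d (@grid_cell R d K c))) 0.
  by rewrite invr0 mulr0.
have vfin : (lebT R d (@grid_cell R d K c) < +oo)%E.
  by move: vnz; case: (lebT R d (@grid_cell R d K c)) => [r| |] /=;
    rewrite ?eqxx// ltry.
have mfc : measurable_fun (@grid_cell R d K c) f.
  exact: measurable_funS measurable_unit_cube (@grid_cell_sub_cube c) mf.
have i1 : (lebT R d).-integrable (@grid_cell R d K c) (EFin \o cst 1).
  apply: measurable_bounded_integrable => //.
  exists 1; split; first by rewrite num_real.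
  by move=> y y1 x _ /=; rewrite normr1 ltW.
have if_ : (lebT R d).-integrable (@grid_cell R d K c) (EFin \o f).
  apply: le_integrable i1 => //; first exact/measurable_EFinP.
  move=> x /cf01 /andP[f0 f1] /=; rewrite lee_fin normr1 ger0_norm//.
rewrite RintegralB// addrC subrK Rintegral_cst// mul1r divff//.
Qed.

End ObsLaw.

(** * Real-valued probabilities and finite partitions *)

Lemma fsbig_finType (R : Type) (idx : R) (op : Monoid.com_law idx)
    (F : finType) (g : F -> R) :
  \big[op/idx]_(x \in [set: F]) g x = \big[op/idx]_x g x.
Proof.
rewrite (@fsbigE _ _ _ _ _ (index_enum F)) ?index_enum_uniq//.
  by apply: eq_bigl => x; rewrite in_setT.
by move=> x _; rewrite mem_index_enum.
Qed.

Section FiniteProbability.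
Context (R : realType) (dO : measure_display) (Omega : measurableType dO).
Variable P : probability Omega R.
Implicit Types (A B E : set Omega).

Definition prob E : R := fine (P E).

Lemma probK E : measurable E -> (prob E)%:E = P E.
Proof. by move=> mE; rewrite /prob fineK// fin_num_measure. Qed.

Lemma prob_ge0 E : 0 <= prob E.
Proof. exact: fine_ge0. Qed.

Lemma le_prob A B : measurable A -> measurable B ->
  A `<=` B -> prob A <= prob B.
Proof.
by move=> mA mB AB; rewrite -lee_fin !probK// le_measure// inE.
Qed.

Lemma prob0 : prob set0 = 0.
Proof. by rewrite /prob measure0. Qed.

Lemma probT : prob setT = 1.
Proof. by rewrite /prob probability_setT. Qed.

Lemma prob_split A E : measurable A -> measurable E ->
  prob E = prob (E `&` A) + prob (E `&` ~` A).
Proof.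
move=> mA mE; apply: EFin_inj; rewrite EFinD !probK//; last 2 first.
- by apply: measurableI => //; exact: measurableC.
- exact: measurableI.
rewrite -measureU//; first by rewrite -setIUr setUv setIT.
- exact: measurableI.
- by apply: measurableI => //; exact: measurableC.
- by rewrite setIACA setICr setI0.
Qed.

Lemma prob_partition (F : finType) (X : Omega -> F) E :
  (forall x, measurable (X @^-1` [set x])) -> measurable E ->
  prob E = \sum_x prob (E `&` X @^-1` [set x]).
Proof.
move=> mX mE; have mEX x : measurable (E `&` X @^-1` [set x])
  by exact: measurableI.
apply: EFin_inj; rewrite -sumEFin probK//.
under eq_bigr do rewrite probK//.
have -> : E = \bigcup_(x in [set: F]) (E `&` X @^-1` [set x]).
  by apply/seteqP; split=> [u Eu|u [x _ [Eu _]]] //; exists (X u).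
rewrite measure_fin_bigcup//;
  [|exact: finite_finset|exact/trivIset_setIl/trivIset_preimage1].
rewrite fsbig_finType; apply: eq_bigr => x _; congr (P _).
apply/seteqP; split=> [u [Eu xu]|u [[x1 _ [Eu _]] xu]] //.
by split=> //; exists x.
Qed.

Lemma prob_union_bound (F : finType) (W : F -> set Omega) E :
  (forall x, measurable (W x)) -> measurable E ->
  (forall o, E o -> exists x, W x o) ->
  prob E <= \sum_x prob (W x).
Proof.
move=> mW mE EW; rewrite -lee_fin -sumEFin probK//.
under eq_bigr do rewrite probK//.
rewrite -fsbig_finType; apply: content_sub_fsum => //;
  first exact: finite_finset.
by move=> o /EW [x]; exists x.
Qed.

End FiniteProbability.

(** * Measurability along a run *)

Section Run.
Context (R : realType) (d K : nat) (dO : measure_display)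
  (Omega : measurableType dO).
Variables (P : probability Omega R) (z : trace R d K Omega).
Variables (Twarm : nat) (tau : R) (f : d.-tuple R -> R) (T : nat).
Hypothesis run : is_run Twarm tau z P f T.
Local Notation cell := (cell d K).
Local Notation selected := (selected Twarm tau z).
Local Notation alpha := (alpha Twarm tau z).
Local Notation beta := (beta Twarm tau z).
Local Notation prob := (prob P).
Implicit Types (c : cell) (E : set Omega).

(** This sigma-algebra is contained in both of those on which the laws of a
round are conditioned, and it grows with t; the induction over rounds needs
one family of events with these properties. *)
Definition past t : set (set Omega) := <<s round_past Twarm tau z t >>.

Definition observed c t b : set Omega :=
  [set o | c \in selected t o /\ resp z t c o = b].

Lemma round_past_mono s t : (s <= t)%N ->
  round_past Twarm tau z s `<=` round_past Twarm tau z t.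
Proof.
move=> st E [r [/andP[r0 rs] h]]; exists r; split=> //.
by rewrite r0 (leq_trans rs).
Qed.

Lemma past_mono s t : (s <= t)%N -> past s `<=` past t.
Proof. by move=> st; apply: sub_sigma_algebra2; exact: round_past_mono. Qed.

Lemma past_obs_past t : past t `<=` obs_past Twarm tau z t.
Proof. by apply: sub_sigma_algebra2; exact: subsetUl. Qed.

Lemma past_draw_past t k : past t `<=` draw_past Twarm tau z t k.
Proof. by apply: sub_sigma_algebra2; exact: subsetUl. Qed.

Lemma observed_past c s b : (0 < s)%N -> past s.+1 (observed c s b).
Proof.
move=> s0; apply: sub_gen_smallest; exists s; rewrite s0 ltnS leqnn; split=> //.
left; exists c, setT, b; split=> //.
by apply/seteqP; split=> [u [? ?]|u [? []]].
Qed.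

Lemma pastI t A B : past t A -> past t B -> past t (A `&` B).
Proof.
exact: (@measurableI _ (g_sigma_algebraType (round_past Twarm tau z t))).
Qed.

Lemma pastC t A : past t A -> past t (~` A).
Proof.
exact: (@measurableC _ (g_sigma_algebraType (round_past Twarm tau z t))).
Qed.

Lemma measurable_proposal t k (D : {set cell}) :
  measurable (proposal tau z t k @^-1` [set D]).
Proof.
have -> : proposal tau z t k @^-1` [set D] = \bigcap_(c in [set: cell])
    (theta z t k c @^-1`
      (if c \in D then `[tau, +oo[ else `]-oo, tau[)%classic).
  apply/seteqP; split=> u.
    move=> /= <- c _; rewrite /proposal finset.inE.
    by rewrite /= leNgt; case: ifP; rewrite /= in_itv/= => /negP;
      rewrite ?leNgt => /negP; rewrite ?negbK ?andbT.
  move=> h; apply/setP => c; rewrite finset.inE; have := h c I.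
  rewrite /=; case: ifP => _; rewrite /= in_itv/= ?andbT => // h1.
  by rewrite leNgt h1.
apply: fin_bigcap_measurable; first exact: finite_finset.
move=> c _; rewrite -[X in measurable X]setTI.
by apply: (measurable_theta run) => //; case: ifP.
Qed.

Lemma selected_warm t o : (t <= Twarm)%N -> selected t o = finset.setT.
Proof. by rewrite /Defs.selected => ->. Qed.

(** A description of the selected set by countably many conditions on the
proposals, from which its measurability can be read off. *)
Lemma selectedP t o (D : {set cell}) : (Twarm < t)%N ->
  selected t o = D <->
  if D == finset.set0 then forall k, proposal tau z t k o = finset.set0
  else exists k, (forall j, (j < k)%N -> proposal tau z t j o = finset.set0) /\
         proposal tau z t k o = D.
Proof.
rewrite ltnNge /Defs.selected => /negbTE ->; case: pselect => [ex|nex].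
  case: ex_minnP => k kn0 kmin.
  have lt_k j : (j < k)%N -> proposal tau z t j o = finset.set0.
    by move=> jk; apply/eqP; apply: contraTT jk => /kmin; rewrite -leqNgt.
  case: eqP => [->|/eqP D0].
    by split=> [e|all0]; [rewrite e eqxx in kn0|exact: all0].
  split=> [<-|]; first by exists k.
  move=> [i [lt_i iD]]; case: (ltngtP i k) => [/lt_k|/lt_i|<-//].
    by rewrite iD => D0'; rewrite D0' eqxx in D0.
  by move=> e; rewrite e eqxx in kn0.
have all0 k : proposal tau z t k o = finset.set0.
  by apply/eqP; apply/negPn/negP => h; apply: nex; exists k.
case: eqP => [->|D0]; split=> //; first by move=> e; case: D0.
by move=> [k [_ e]]; rewrite -e all0.
Qed.

Lemma measurable_reached t k : measurable (reached Twarm tau z t k).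
Proof.
have -> : reached Twarm tau z t k = [set _ | (Twarm < t)%N] `&`
  \bigcap_(j in `I_k) (proposal tau z t j @^-1` [set finset.set0]).
  by apply/seteqP; split=> u [? h]; split=> // j jk; exact: h.
apply: measurableI.
  case: (Twarm < t)%N.
    by rewrite (_ : mkset _ = setT)//; apply/seteqP; split.
  by rewrite (_ : mkset _ = set0)//; apply/seteqP; split.
apply: fin_bigcap_measurable; first exact: finite_II.
by move=> j _; exact: measurable_proposal.
Qed.

Lemma measurable_selected t (D : {set cell}) :
  measurable (selected t @^-1` [set D]).
Proof.
have [tw|tw] := leqP t Twarm.
  rewrite (_ : _ @^-1` _ = if D == finset.setT then setT else set0);
    first by case: ifP.
  apply/seteqP; split=> u; rewrite /= selected_warm//.
    by move=> <-; rewrite eqxx.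
  by case: eqP.
have -> : selected t @^-1` [set D] =
  if D == finset.set0 then \bigcap_k
      (proposal tau z t k @^-1` [set finset.set0])
  else \bigcup_k (reached Twarm tau z t k `&` proposal tau z t k @^-1` [set D]).
  apply/seteqP; split=> u.
    move/(selectedP _ _ tw); case: ifP => _ h; first by move=> k _; exact: h.
    by have [k [h1 h2]] := h; exists k.
  move=> h; apply/(selectedP _ _ tw); move: h; case: ifP => _ h.
    by move=> k; exact: (h k I).
  by have [k _ [[_ h1] h2]] := h; exists k.
case: ifP => _.
  by apply: bigcapT_measurable => k; exact: measurable_proposal.
apply: bigcupT_measurable => k; apply: measurableI;
  first exact: measurable_reached.
exact: measurable_proposal.
Qed.

Lemma measurable_in_selected t c : measurable [set o | c \in selected t o].
Proof.
have -> : [set o | c \in selected t o] =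
    \bigcup_(D in [set D : {set cell} | c \in D]) (selected t @^-1` [set D]).
  by apply/seteqP; split=> [u cu|u [D cD] /= ->//]; exists (selected t u).
apply: fin_bigcup_measurable; first exact: finite_finset.
by move=> D _; exact: measurable_selected.
Qed.

Lemma measurable_observed c t b : measurable (observed c t b).
Proof.
apply: (@measurableI _ _ _ (resp z t c @^-1` [set b])).
  exact: measurable_in_selected.
rewrite -[X in measurable X]setTI; exact: (measurable_resp run t c measurableT).
Qed.

Lemma measurable_past t E : past t E -> measurable E.
Proof.
apply: smallest_sub; first exact: sigma_algebra_measurable.
move=> A [s [_ [[c [B [b [mB ->]]]]|[k [c [B [mB ->]]]]]]].
  rewrite (_ : mkset _ = observed c s b `&` Defs.point z s c @^-1` B).
    apply: measurableI; first exact: measurable_observed.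
    rewrite -[X in measurable X]setTI;
      exact: (measurable_point run s c measurableT).
  by apply/seteqP; split=> [u [? [? ?]]|u [[? ?] ?]].
apply: (@measurableI _ _ _ (theta z s k c @^-1` B));
  first exact: measurable_reached.
rewrite -[X in measurable X]setTI;
  exact: (measurable_theta run s k c measurableT).
Qed.

(** Up to their initial value 1, the posterior parameters are counts of this
form. *)
Lemma measurable_count (g : nat -> pred Omega) t :
  (forall s, measurable [set o | g s o]) ->
  measurable_fun setT (fun o => \sum_(1 <= s < t) g s o)%N.
Proof.
move=> mg; elim: t => [|t IH].
  by rewrite (_ : (fun _ => _) = cst 0%N)//; apply/funext => u; rewrite big_geq.
have [t0|t0] := posnP t.
  by rewrite t0 (_ : (fun _ => _) = cst 0%N)//; apply/funext => u;
    rewrite big_geq.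
under eq_fun do rewrite big_nat_recr//=.
apply: measurable_fun_addn => //.
apply: (@measurableT_comp _ _ _ _ _ _ nat_of_bool) => //.
apply: (measurable_fun_bool true); rewrite setTI.
by rewrite (_ : _ @^-1` _ = [set o | g t o]).
Qed.

Lemma measurable_alpha t c : measurable_fun setT (alpha t c).
Proof.
apply: measurable_fun_addn; first exact: measurable_cst.
apply: measurable_count => s; rewrite (_ : mkset _ = observed c s true).
  exact: measurable_observed.
by apply/seteqP; split=> u; [move=> /andP|move=> [h1 h2]; apply/andP].
Qed.

Lemma measurable_beta t c : measurable_fun setT (beta t c).
Proof.
apply: measurable_fun_addn; first exact: measurable_cst.
apply: measurable_count => s; rewrite (_ : mkset _ = observed c s false).
  exact: measurable_observed.
apply/seteqP; split=> u; first by move=> /andP[h1 /negbTE].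
by move=> [h1 h2]; apply/andP; rewrite h2.
Qed.

(** * Conditional laws for a single cell *)

Hypothesis obs_ge0 : forall c b, 0 <= obs_law f c setT b.
Hypothesis obs_le1 : forall c,
  obs_law f c setT true + obs_law f c setT false <= 1.

Lemma measurable_resp_eq t (D : {set cell}) (y : cell -> bool) :
  measurable [set o | forall c, c \in D -> resp z t c o = y c].
Proof.
rewrite (_ : mkset _ = \bigcap_(c in [set c | c \in D])
  (resp z t c @^-1` [set y c])).
  apply: fin_bigcap_measurable; first exact: finite_finset.
  move=> c _; rewrite -[X in measurable X]setTI.
  by apply: (measurable_resp run).
by apply/seteqP; split=> u h c cD; exact: h.
Qed.

(** A marginal of the joint law of the responses: summing over the responses of
the other cells of D gives a product of sums, by distributivity, and each
factor is at most 1. *)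
Lemma prob_resp_selected t E (D : {set cell}) c b :
  (0 < t <= T)%N -> past t E -> c \in D ->
  prob (E `&` selected t @^-1` [set D] `&` resp z t c @^-1` [set b]) <=
  prob (E `&` selected t @^-1` [set D]) * obs_law f c setT b.
Proof.
move=> tT pE cD; set E' := E `&` _.
have mE' : measurable E'.
  by apply: measurableI; [exact: measurable_past pE|exact: measurable_selected].
have mr c' : measurable_fun setT (resp z t c')
  by exact: measurable_resp run t c'.
(* Outside D the pattern of responses is set to false, so that patterns
   correspond to functions on D. *)
pose X o : {ffun cell -> bool} := [ffun c' => (c' \in D) && resp z t c' o].
have XE y : X @^-1` [set y] = \bigcap_(c' in [set: cell])
    [set o | (c' \in D) && resp z t c' o = y c'].
  apply/seteqP; split=> u; first by move=> <- c' _; rewrite /= ffunE.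
  by move=> h; apply/ffunP => c'; rewrite ffunE; exact: (h c' I).
have mX y : measurable (X @^-1` [set y]).
  rewrite XE; apply: fin_bigcap_measurable; first exact: finite_finset.
  move=> c' _; case: (c' \in D) => /=.
    by rewrite -[X in measurable X]setTI; exact: (mr c' measurableT [set y c']).
  case: (y c').
    by rewrite (_ : mkset _ = set0)//; apply/seteqP; split.
  by rewrite (_ : mkset _ = setT)//; apply/seteqP; split.
have mEr : measurable (E' `&` resp z t c @^-1` [set b]).
  apply: measurableI => //.
  by rewrite -[X in measurable X]setTI; exact: (mr c measurableT [set b]).
rewrite (prob_partition P mX mEr).
pose Q c' b' := (c' == c) ==> (b' == b).
rewrite (bigID (fun y : {ffun cell -> bool} =>
  y \in pfamily false (mem D) Q))/=.
rewrite [X in _ + X]big1 ?addr0; last first.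
  move=> y yQ; rewrite (_ : _ `&` _ = set0) ?prob0//.
  apply/seteqP; split=> // u [[E'u /= ru] Xu]; move/negP: yQ; apply.
  apply/pfamilyP; split.
    apply/fintype.subsetP => c'; rewrite unfold_in -Xu ffunE.
    by case: (c' \in D).
  move=> c' c'D; rewrite -Xu unfold_in /Q ffunE; apply/implyP => /eqP ->.
  by rewrite cD ru.
have step y : prob (E' `&` resp z t c @^-1` [set b] `&` X @^-1` [set y]) <=
    prob E' * \prod_(c' in D) obs_law f c' setT (y c').
  have := @point_resp_law _ _ _ _ _ _ _ _ _ _ _ run t E D (fun _ => setT) y tT
    (past_obs_past pE) (fun=> measurableT).
  rewrite (_ : [set o | forall c', c' \in D -> [set: d.-tuple R] _ /\ _] =
    [set o | forall c', c' \in D -> resp z t c' o = y c']); last first.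
    by apply/seteqP; split=> u h c' /h; [case|].
  rewrite -/E' /= => /(congr1 fine); rewrite fineM ?fin_num_measure// => <-.
  apply: le_prob.
  - exact: measurableI.
  - have mB := @measurable_resp_eq t D y.
    by apply: measurableI => //.
  - by move=> u [[E'u _] Xu]; split=> // c' c'D; rewrite -Xu ffunE c'D.
apply: le_trans (ler_sum _ (fun y _ => step y)) _.
rewrite -mulr_sumr ler_wpM2l ?prob_ge0//.
rewrite -(big_distr_big_dep _ _ _ (fun c' b' => obs_law f c' setT b')).
rewrite (bigD1 c)//= -[leRHS]mulr1; apply: ler_pM.
- by apply: sumr_ge0.
- by apply: prodr_ge0 => c' _; apply: sumr_ge0.
- by rewrite /Q eqxx/= big_pred1_eq.
- apply: prodr_ile1 => c' /andP[_ c'c]; rewrite sumr_ge0//=.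
  by rewrite /Q (negbTE c'c) (eq_bigl xpredT)// big_bool; exact: obs_le1.
Qed.

(** The previous bound summed over all sets D containing c. *)
Lemma prob_observed_le t E c b : (0 < t <= T)%N -> past t E ->
  prob (E `&` observed c t b) <=
  prob (E `&` [set o | c \in selected t o]) * obs_law f c setT b.
Proof.
move=> tT pE; have mE := measurable_past pE.
have mO := measurable_observed c t b.
have mS := measurable_in_selected t c.
rewrite (prob_partition P (measurable_selected t) (measurableI _ _ mE mO)).
rewrite (prob_partition P (measurable_selected t) (measurableI _ _ mE mS)).
rewrite mulr_suml; apply: ler_sum => D _.
have mD := measurable_selected t D.
have [cD|cD] := boolP (c \in D); last first.
  rewrite (_ : _ `&` _ `&` _ = set0).
    by rewrite prob0; apply: mulr_ge0; [exact: prob_ge0|exact: obs_ge0].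
  apply/seteqP; split=> // u [[_ [cu _]] /= uD].
  by rewrite -uD cu in cD.
have -> : E `&` [set o | c \in selected t o] `&` selected t @^-1` [set D] =
    E `&` selected t @^-1` [set D].
  apply/seteqP; split=> u [h1 h2]; first by have [] := h1.
  by split=> //; split=> //=; rewrite h2.
apply: le_trans (prob_resp_selected b tT pE cD).
apply: le_prob.
- by apply: measurableI => //; exact: measurableI.
- apply: measurableI; first exact: measurableI.
  by rewrite -[X in measurable X]setTI; apply: (measurable_resp run).
- by move=> u [[Eu [_ ru]] uD].
Qed.

(** The law of a first draw is known once the parameters of all cells are
fixed; as the one of c depends on its own parameters only, summing over the
finitely many values of the others leaves a single Beta factor. *)
Lemma prob_theta_given_counts t E c i j B : (Twarm < t <= T)%N -> past t E ->
  measurable B ->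
  (forall o, E o -> alpha t c o = i /\ beta t c o = j) ->
  prob (E `&` theta z t 0 c @^-1` B) = prob E * fine (beta_prob i j B).
Proof.
move=> /[dup] tT /andP[tw _] pE mB Eij; have mE := measurable_past pE.
have mth : measurable (theta z t 0 c @^-1` B).
  by rewrite -[X in measurable X]setTI; apply: (measurable_theta run).
have count_le (g : nat -> bool) : (\sum_(1 <= s < t) g s < t)%N.
  have t0 : (0 < t)%N by exact: leq_ltn_trans tw.
  apply: (@leq_ltn_trans (\sum_(1 <= s < t) 1)%N).
    by apply: leq_sum => s _; exact: leq_b1.
  by rewrite sum_nat_const_nat muln1 subn1 prednK.
have alpha_lt c' o : (alpha t c' o < t.+1)%N by rewrite ltnS count_le.
have beta_lt c' o : (beta t c' o < t.+1)%N by rewrite ltnS count_le.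
pose X o : {ffun cell -> 'I_t.+1 * 'I_t.+1} :=
  [ffun c' => (Ordinal (alpha_lt c' o), Ordinal (beta_lt c' o))].
have XE (y : {ffun cell -> 'I_t.+1 * 'I_t.+1}) : X @^-1` [set y] =
    [set o | forall c', alpha t c' o = (y c').1 /\ beta t c' o = (y c').2].
  apply/seteqP; split=> u; first by move=> <- c'; rewrite ffunE.
  move=> h; apply/ffunP => c'; rewrite ffunE [RHS]surjective_pairing.
  by have [h1 h2] := h c'; congr (_, _); apply: val_inj.
have mX y : measurable (X @^-1` [set y]).
  rewrite XE (_ : mkset _ = \bigcap_(c' in [set: cell])
    (alpha t c' @^-1` [set nat_of_ord (y c').1] `&`
     beta t c' @^-1` [set nat_of_ord (y c').2])); last first.
    by apply/seteqP; split=> u h c'; [move=> _|]; exact: h.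
  apply: fin_bigcap_measurable; first exact: finite_finset.
  move=> c' _; apply: measurableI; rewrite -[X in measurable X]setTI.
    by apply: measurable_alpha.
  by apply: measurable_beta.
rewrite (prob_partition P mX (measurableI _ _ mE mth)).
rewrite [in RHS](prob_partition P mX mE) mulr_suml; apply: eq_bigr => y _.
have [[u [Eu Xu]]|noU] := pselect (exists u, E u /\ X u = y); last first.
  have e0 : E `&` X @^-1` [set y] = set0.
    by apply/seteqP; split=> // u [Eu Xu]; apply: noU; exists u.
  by rewrite setIAC e0 set0I prob0 mul0r.
have [iE jE] : i = (y c).1 /\ j = (y c).2.
  by have [<- <-] := Eij u Eu; rewrite -Xu ffunE.
pose B' c' : set R := if c' == c then B else setT.
have mB' c' : measurable (B' c') by rewrite /B'; case: ifP.
have := @draw_law _ _ _ _ _ _ _ _ _ _ _ run t 0 E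
  (fun c' => (y c').1) (fun c' => (y c').2) B' tT (past_draw_past pE) mB'.
have -> : reached Twarm tau z t 0 = setT by apply/seteqP; split.
rewrite setIT -XE /=.
have -> : [set o | forall c', B' c' (theta z t 0 c' o)] = theta z t 0 c @^-1` B.
  apply/seteqP; split=> v; first by move=> /(_ c); rewrite /B' eqxx.
  by move=> h c'; rewrite /B'; case: eqP => // ->.
have mEX : measurable (E `&` X @^-1` [set y]) by exact: measurableI.
rewrite setIAC => /(congr1 fine); rewrite fineM ?fin_num_measure// => e.
rewrite /prob e; congr (_ * _).
rewrite /= (bigD1 c)//= big1 ?mulr1; first by rewrite /B' eqxx iE jE.
by move=> c' /negbTE c'c; rewrite /B' c'c probability_setT.
Qed.

(** * Decay of the probability of a deviating draw *)

Lemma alphaS s c o : (0 < s)%N ->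
  alpha s.+1 c o = (alpha s c o + ((c \in selected s o) && resp z s c o))%N.
Proof. by move=> s0; rewrite /Defs.alpha big_nat_recr// addnA. Qed.

Lemma betaS s c o : (0 < s)%N ->
  beta s.+1 c o = (beta s c o + ((c \in selected s o) && ~~ resp z s c o))%N.
Proof. by move=> s0; rewrite /Defs.beta big_nat_recr// addnA. Qed.

Lemma unobservedE c s :
  ~` observed c s true `&` ~` observed c s false =
    ~` [set o | c \in selected s o].
Proof.
apply/seteqP; split=> u.
  by move=> [h1 h0] cu; case: (boolP (resp z s c u)) => [r|/negbTE r];
    [apply: h1|apply: h0].
by move=> cu; split=> -[].
Qed.

(** W i j stands for a bound on the probability of B under
Beta(i + 1, j + 1), contracting on average by rho at each observation. *)
Section Decay.
Variables (c : cell) (B : set R) (W : nat -> nat -> R) (rho : R) (t : nat).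
Hypothesis tT : (Twarm < t <= T)%N.
Hypothesis mB : measurable B.
Hypothesis rho01 : 0 <= rho <= 1.
Hypothesis W_ge0 : forall i j, 0 <= W i j.
Hypothesis tail_le : forall i j, fine (beta_prob i.+1 j.+1 B) <= W i j.
Hypothesis W_contract : forall i j,
  obs_law f c setT true * W i.+1 j + obs_law f c setT false * W i j.+1 <=
    rho * W i j.

(** Induction on the number n of rounds between s and t.  Round s splits E
according to whether c is observed and with which response; the induction
hypothesis applies to each of the three parts, with updated counts.  During
the warm-up the part where c is not observed is empty, which gains a factor
rho; afterwards rho <= 1 suffices. *)
Lemma prob_theta_decay n s E i j : (0 < s)%N -> (s + n = t)%N -> past s E ->
  (forall o, E o -> alpha s c o = i.+1 /\ beta s c o = j.+1) ->
  prob (E `&` theta z t 0 c @^-1` B) <=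
    prob E * (W i j * rho ^+ (Twarm.+1 - s)).
Proof.
have /andP[rho0 rho1] := rho01; have /andP[tw tleT] := tT.
have mth : measurable (theta z t 0 c @^-1` B).
  by rewrite -[X in measurable X]setTI; apply: (measurable_theta run).
elim: n s E i j => [|n IH] s E i j s0 st pE Eij.
  rewrite addn0 in st; subst s.
  rewrite (prob_theta_given_counts tT pE mB Eij) ler_wpM2l ?prob_ge0//.
  by rewrite (eqP (_ : (Twarm.+1 - t == 0)%N)) ?subn_eq0// expr0 mulr1.
have mE := measurable_past pE.
have sT : (0 < s <= T)%N.
  by rewrite s0 (leq_trans _ tleT)// -st leq_addr.
pose S := [set o | c \in selected s o].
have mS : measurable S := measurable_in_selected s c.
have m1 := measurable_observed c s true;
  have m0 := measurable_observed c s false.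
have pE' := past_mono (leqnSn s) pE.
have p1 := observed_past c true s0; have p0 := observed_past c false s0.
set q := rho ^+ (Twarm.+1 - s.+1).
have q0 : 0 <= q by exact: exprn_ge0.
have st' : (s.+1 + n = t)%N by rewrite addSnnS.
have b1 : prob (E `&` observed c s true `&` theta z t 0 c @^-1` B) <=
    prob (E `&` observed c s true) * (W i.+1 j * q).
  apply: IH => //; first exact: pastI.
  move=> u [/Eij [aE bE] [cu ru]].
  by rewrite alphaS// betaS// cu ru aE bE /= addn1 addn0.
have b0 : prob (E `&` observed c s false `&` theta z t 0 c @^-1` B) <=
    prob (E `&` observed c s false) * (W i j.+1 * q).
  apply: IH => //; first exact: pastI.
  move=> u [/Eij [aE bE] [cu ru]].
  by rewrite alphaS// betaS// cu ru aE bE /= addn1 addn0.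
have bN : prob (E `&` ~` S `&` theta z t 0 c @^-1` B) <=
    prob (E `&` ~` S) * (W i j * q).
  apply: IH => //.
    rewrite -unobservedE; apply: pastI => //.
    by apply: pastI; apply: pastC.
  move=> u [/Eij [aE bE] /negP/negbTE cu].
  by rewrite alphaS// betaS// cu aE bE /= !addn0.
have o1 := prob_observed_le c true sT pE.
have o0 := prob_observed_le c false sT pE.
rewrite -/S in o1 o0.
have split3 : prob (E `&` theta z t 0 c @^-1` B) =
    prob (E `&` observed c s true `&` theta z t 0 c @^-1` B) +
    prob (E `&` observed c s false `&` theta z t 0 c @^-1` B) +
    prob (E `&` ~` S `&` theta z t 0 c @^-1` B).
  rewrite (prob_split P m1 (measurableI _ _ mE mth)) setIAC -addrA;
    congr (_ + _).
  rewrite (prob_split P m0); last first.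
    by apply: measurableI; [exact: measurableI|exact: measurableC].
  congr (prob _ + prob _).
    apply/seteqP; split=> u; first by move=> [[[]]].
    by move=> [[Eu ou] thu]; split=> //; split=> // -[_]; case: ou => _ ->.
  by rewrite -setIA unobservedE setIAC.
have sumE := prob_split P mS mE.
have w1 := ler_wpM2r (mulr_ge0 (W_ge0 i.+1 j) q0) o1.
have w0 := ler_wpM2r (mulr_ge0 (W_ge0 i j.+1) q0) o0.
have eS0 := prob_ge0 P (E `&` S); have eN0 := prob_ge0 P (E `&` ~` S).
have wc := ler_wpM2l (mulr_ge0 eS0 q0) (W_contract i j).
have main : prob (E `&` theta z t 0 c @^-1` B) <=
    prob (E `&` S) * (rho * W i j * q) + prob (E `&` ~` S) * (W i j * q).
  rewrite split3; lra.
have [sw|sw] := leqP s Twarm.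
  have N0 : prob (E `&` ~` S) = 0.
    rewrite (_ : ~` S = set0) ?setI0 ?prob0//.
    by apply/seteqP; split=> // u; apply; rewrite /S /= selected_warm//
      finset.inE.
  apply: (le_trans main); rewrite sumE N0 mul0r !addr0 subSn// exprS.
  by rewrite (mulrC rho) -mulrA.
have q1 : q = 1 by rewrite /q (eqP (_ : Twarm.+1 - s.+1 == 0)%N)//
  subn_eq0 ltnW.
rewrite (eqP (_ : (Twarm.+1 - s == 0)%N)) ?subn_eq0// expr0.
apply: (le_trans main); rewrite q1 !mulr1 sumE mulrDl lerD2r.
by rewrite ler_wpM2l// ler_piMl.
Qed.

Corollary prob_theta_le : prob (theta z t 0 c @^-1` B) <= W 0 0 * rho ^+ Twarm.
Proof.
have /andP[tw _] := tT.
have := @prob_theta_decay t.-1 1 setT 0 0 isT; rewrite add1n prednK; last first.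
  exact: leq_ltn_trans tw.
rewrite setTI probT mul1r subn1; apply=> //.
  by apply: (@measurableT _ (g_sigma_algebraType (round_past Twarm tau z 1))).
by move=> o _; rewrite /Defs.alpha /Defs.beta !big_geq.
Qed.

End Decay.

End Run.

(** * The two kinds of deviation *)

Section Tails.
Context (R : realType) (d K : nat) (dO : measure_display)
  (Omega : measurableType dO).
Variables (P : probability Omega R) (z : trace R d K Omega).
Variables (Twarm : nat) (tau Delta : R) (f : d.-tuple R -> R) (T : nat).
Hypothesis run : is_run Twarm tau z P f T.
Hypothesis Delta01 : 0 < Delta <= 1.
Hypothesis tau01 : 0 <= tau <= 1.
Hypothesis obs_ge0 : forall (c : cell d K) b, 0 <= obs_law f c setT b.
Hypothesis obs_le1 : forall c : cell d K,
  obs_law f c setT true + obs_law f c setT false <= 1.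
Variable t : nat.
Hypothesis tT : (Twarm < t <= T)%N.
Variable c : cell d K.
Local Notation mu := (obs_law f c setT true).

Let rho01 : 0 <= 1 - Delta ^+ 2 / 8 <= 1.
Proof. by have /andP[? ?] := Delta01; apply/andP; split; nra. Qed.

Let damping_factor (s : R) : 0 <= s <= 1 -> 0 <= 1 - s + s / (1 + Delta) <= 1.
Proof.
move=> /andP[s0 s1]; have /andP[D0 D1] := Delta01.
have h : s / (1 + Delta) <= s by rewrite ler_pdivrMr; nra.
have h' : 0 <= s / (1 + Delta) by rewrite divr_ge0//; lra.
lra.
Qed.

Lemma prob_theta_ge : mu + Delta / 2 <= tau ->
  prob P (theta z t 0 c @^-1` `[tau, +oo[) <= (1 - Delta ^+ 2 / 8) ^+ Twarm.
Proof.
move=> mutau; have /andP[D0 D1] := Delta01; have /andP[t0 t1] := tau01.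
set q := 1 - tau + tau / (1 + Delta).
have /andP[q0 q1] := damping_factor tau01; rewrite -/q in q0 q1.
have x0 : 0 <= 1 + Delta by lra.
pose W i j := (1 + Delta) ^+ i * q ^+ (i + j).+1.
have W0 i j : 0 <= W i j by rewrite mulr_ge0 ?exprn_ge0.
apply: (le_trans (@prob_theta_le _ _ _ _ _ P z Twarm tau f T run obs_ge0 obs_le1
  c `[tau, +oo[%classic W (1 - Delta ^+ 2 / 8) t tT _ rho01 W0 _ _)) => //.
- move=> i j; rewrite -lee_fin fineK ?fin_num_measure//.
  by apply: beta_prob_ge_le => //; rewrite lerDl ltW.
- move=> i j; have p1 := obs_ge0 c true; have p0 := obs_ge0 c false.
  have p01 := obs_le1 c.
  have rate := chernoff_rate Delta01 p1 t1 mutau; rewrite -/q in rate.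
  have -> : mu * W i.+1 j + obs_law f c setT false * W i j.+1 =
      W i j * (q * (mu * (1 + Delta) + obs_law f c setT false)).
    by rewrite /W addSn addnS !exprS; ring.
  rewrite [leRHS]mulrC ler_wpM2l//; apply: le_trans rate.
  by rewrite ler_wpM2l//; lra.
- rewrite ler_piMl ?exprn_ge0//; first by have /andP[] := rho01.
  by rewrite /W expr0 mul1r expr1.
Qed.

(** The previous argument with successes and failures exchanged: the roles of
mu and tau are played by 1 - mu and 1 - tau. *)
Lemma prob_theta_lt : tau + Delta / 2 <= mu ->
  prob P (theta z t 0 c @^-1` `]-oo, tau[) <= (1 - Delta ^+ 2 / 8) ^+ Twarm.
Proof.
move=> mutau; have /andP[D0 D1] := Delta01; have /andP[t0 t1] := tau01.
set q := tau + (1 - tau) / (1 + Delta).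
have qE : 1 - (1 - tau) + (1 - tau) / (1 + Delta) = q by rewrite subKr.
have tau01' : 0 <= 1 - tau <= 1 by lra.
have /andP[q0 q1] := damping_factor tau01'; rewrite qE in q0 q1.
have x0 : 0 <= 1 + Delta by lra.
pose W i j := (1 + Delta) ^+ j * q ^+ (i + j).+1.
have W0 i j : 0 <= W i j by rewrite mulr_ge0 ?exprn_ge0.
apply: (le_trans (@prob_theta_le _ _ _ _ _ P z Twarm tau f T run obs_ge0 obs_le1
  c `]-oo, tau[%classic W (1 - Delta ^+ 2 / 8) t tT _ rho01 W0 _ _)) => //.
- move=> i j; rewrite -lee_fin fineK ?fin_num_measure//.
  by apply: beta_prob_lt_le => //; rewrite lerDl ltW.
- move=> i j; have p1 := obs_ge0 c true; have p0 := obs_ge0 c false.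
  have p01 := obs_le1 c.
  have := @chernoff_rate _ Delta (1 - mu) (1 - tau) Delta01; rewrite qE => rate.
  have -> : mu * W i.+1 j + obs_law f c setT false * W i j.+1 =
      W i j * (q * (mu + obs_law f c setT false * (1 + Delta))).
    by rewrite /W addSn addnS !exprS; ring.
  rewrite [leRHS]mulrC ler_wpM2l//; apply: (le_trans _ (rate _ _ _)); [|lra..].
  rewrite ler_wpM2l//; nra.
- rewrite ler_piMl ?exprn_ge0//; first by have /andP[] := rho01.
  by rewrite /W expr0 mul1r expr1.
Qed.

End Tails.

(** * From single draws to selections *)

Section Selection.
Context (R : realType) (d K : nat) (dO : measure_display)
  (Omega : measurableType dO).
Variables (P : probability Omega R) (z : trace R d K Omega).
Variables (Twarm : nat) (tau : R) (f : d.-tuple R -> R) (T : nat).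
Hypothesis run : is_run Twarm tau z P f T.
Local Notation selected := (selected Twarm tau z).

(** As D is nonempty, regeneration does not occur. *)
Lemma first_proposal_selected t o (D : {set cell d K}) :
  (Twarm < t)%N -> D != finset.set0 -> proposal tau z t 0 o = D ->
  selected t o = D.
Proof.
by move=> tw /negbTE D0 pD; apply/(selectedP _ _ _ _ tw); rewrite D0;
  exists 0%N.
Qed.

Lemma measurable_misselected t (D : {set cell d K}) :
  measurable [set o | selected t o != D].
Proof.
rewrite (_ : mkset _ = ~` (selected t @^-1` [set D])).
  by apply: measurableC; exact: (measurable_selected run).
by apply/seteqP; split=> u /eqP.
Qed.

Lemma prob_misselected_le t (D : {set cell d K}) (e : R) : (Twarm < t <= T)%N ->
  D != finset.set0 ->
  (forall c, c \in D -> prob P (theta z t 0 c @^-1` `]-oo, tau[) <= e) ->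
  (forall c, c \notin D -> prob P (theta z t 0 c @^-1` `[tau, +oo[) <= e) ->
  prob P [set o | selected t o != D] <= (K ^ d)%:R * e.
Proof.
move=> /andP[tw _] D0 eD eN.
pose Wrong c := theta z t 0 c @^-1`
  (if c \in D then `]-oo, tau[ else `[tau, +oo[)%classic.
apply: (@le_trans _ _ (\sum_(c : cell d K) prob P (Wrong c))).
  apply: prob_union_bound.
  - move=> c; rewrite -[X in measurable X]setTI.
    by apply: (measurable_theta run) => //; case: ifP.
  - exact: measurable_misselected.
  move=> o /= /eqP oD; apply: contrapT => noW; apply: oD.
  apply: first_proposal_selected => //; apply/setP => c; rewrite finset.inE.
  apply/idP/idP => h; apply/negPn/negP => h'; apply: noW; exists c;
    rewrite /Wrong /=.
    by rewrite (negbTE h') /= in_itv/= andbT.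
  by rewrite h /= in_itv/= ltNge.
apply: (@le_trans _ _ (\sum_(c : cell d K) e)).
  by apply: ler_sum => c _; rewrite /Wrong; case: ifPn => ?;
    [exact: eD|exact: eN].
by rewrite sumr_const card_ffun !card_ord mulr_natl.
Qed.

Lemma expectation_misselected (D : {set cell d K}) :
  ('E_P[fun o => ((\sum_(1 <= t < T.+1) (selected t o != D)%:R) / T%:R)%R])%E =
  ((\sum_(1 <= t < T.+1) prob P [set o | selected t o != D]) / T%:R)%:E.
Proof.
pose A t := [set o | selected t o != D].
have mA t : measurable (A t) by exact: measurable_misselected.
rewrite unlock.
under eq_integral => o _.
  rewrite EFinM -sumEFin.
  over.
have AE t o : (selected t o != D)%:R = \1_(A t) o :> R.
  rewrite indicE (_ : (o \in A t) = (selected t o != D))//.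
  by apply/idP/idP; rewrite in_setE.
have mAE t : measurable_fun setT (fun o => ((selected t o != D)%:R : R)%:E).
  under eq_fun do rewrite AE.
  exact/measurable_EFinP/measurable_indic.
rewrite ge0_integralZr//; last 2 first.
- exact: emeasurable_sum.
- by move=> o _; apply: sume_ge0 => t _; rewrite lee_fin.
rewrite ge0_integral_sum//.
rewrite EFinM -sumEFin; congr (_ * _)%E; apply: eq_bigr => t _.
rewrite probK//; last exact: mA.
transitivity (\int[P]_o (\1_(A t) o)%:E)%E.
  by apply: eq_integral => o _; rewrite AE.
by rewrite integral_indic// setIT.
Qed.

End Selection.

Unset Implicit Arguments.

Theorem theorem6 (R : realType) (d K T : nat) (f : d.-tuple R -> R)
    (pR w nu : R) (dO : measure_display) (Omega : measurableType dO)
    (P : probability Omega R) (z : trace R d K Omega)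
    (M := (K ^ d)%N)
    (Delta := gap K f pR w)
    (tau := midpoint K f pR w)
    (Twarm := Num.truncn (nu * T%:R))
    (S := selected Twarm tau z) :
  (0 < d)%N -> (0 < K)%N -> (0 < T)%N ->
  measurable_fun (@unit_cube R d) f ->
  (forall x, @unit_cube R d x -> 0 <= f x <= 1) ->
  0 < pR < 1 ->
  (0 < lebT R d (X_R f pR))%E ->
  (0 < lebT R d (@unit_cube R d `\` X_R f pR))%E ->
  lebT R d [set x | unit_cube x /\ f x = pR] = 0%E ->
  0 < w ->
  M_dense K f pR w != finset.set0 ->
  M_sparse K f pR w != finset.set0 ->
  0 < Delta ->
  0 < nu < 1 ->
  nu > (32 * ln T%:R / Delta ^+ 2 + 1) / T%:R ->
  is_run Twarm tau z P f T ->
  ('E_P[ (fun o => (\sum_(1 <= t < T.+1) (S t o != M_dense K f pR w)%:R)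
                   / T%:R)%R ]
   <= (nu + M%:R / T%:R * (1 + 16 / Delta ^+ 2))%:E)%E.
Proof.
move=> _ K0 T0 mf f01 _ _ _ _ _ dense0 _ D0 /andP[nu0 nu1] nu_low run.
have law c := @obs_law_bounds R d K f K0 mf f01 c.
have obs_ge0 (c : cell d K) b : 0 <= obs_law f c setT b.
  by have [e ? ? _] := law c; case: b; rewrite ?e.
have obs_le1 (c : cell d K) :
    obs_law f c setT true + obs_law f c setT false <= 1.
  by have [-> _ _ ] := law c.
have min1 : min_dense K f pR w <= 1 by exact: bigmin_le_id.
have max0 : 0 <= max_sparse K f pR w by exact: bigmax_ge_id.
have DeltaE : Delta = min_dense K f pR w - max_sparse K f pR w by [].
have tauE : tau = (min_dense K f pR w + max_sparse K f pR w) / 2 by [].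
have Delta01 : 0 < Delta <= 1 by rewrite D0 DeltaE/=; lra.
have tau01 : 0 <= tau <= 1 by rewrite tauE; lra.
have rate := warm_up_suffices Delta01 T0 nu_low.
rewrite -/Twarm in rate.
have T0' : 0 < T%:R :> R by rewrite ltr0n.
have late t : (Twarm < t <= T)%N ->
    prob P [set o | S t o != M_dense K f pR w] <= M%:R / T%:R.
  move=> tT; apply: (prob_misselected_le run tT dense0) => c cD;
    apply: le_trans rate.
    apply: (prob_theta_lt run) => //; have [-> _ _ _] := law c.
    have : min_dense K f pR w <= cell_prob f c by exact: bigmin_le_cond.
    by rewrite tauE DeltaE; lra.
  apply: (prob_theta_ge run) => //; have [-> _ _ _] := law c.
  have : cell_prob f c <= max_sparse K f pR w.
    apply: le_bigmax_cond; move: cD; rewrite /M_dense finset.in_setC;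
      exact: negbNE.
  by rewrite tauE DeltaE; lra.
rewrite (expectation_misselected run) lee_fin.
have Twarm_nu : Twarm%:R <= nu * T%:R by rewrite truncn_le mulr_ge0// ltW.
have sum_le : \sum_(1 <= t < T.+1) prob P [set o | S t o != M_dense K f pR w] <=
    \sum_(1 <= t < T.+1) ((t <= Twarm)%N%:R + M%:R / T%:R).
  apply: ler_sum_nat => t /andP[t1 tT]; have [tw|tw] := leqP t Twarm.
    rewrite -[leLHS]addr0 lerD ?divr_ge0//.
    rewrite -(probT P) le_prob//; exact: (measurable_misselected run).
  by rewrite add0r late// tw -ltnS.
have warm_count : \sum_(1 <= t < T.+1) (t <= Twarm)%N%:R <= Twarm%:R :> R.
  rewrite -natr_sum ler_nat (big_cat_nat (n := Twarm.+1))//=; last first.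
    by rewrite ltnS -(ler_nat R) (le_trans Twarm_nu)// ler_piMl// ltW.
  rewrite [X in (_ + X)%N]big_nat_cond [X in (_ + X)%N]big1 ?addn0.
    apply: (@leq_trans (\sum_(1 <= t < Twarm.+1) 1)%N).
      by apply: leq_sum => t _; exact: leq_b1.
    by rewrite sum_nat_const_nat muln1 subn1.
  by move=> t /andP[/andP[tw _] _]; rewrite leqNgt tw.
rewrite big_split/= sumr_const_nat subn1/= -[X in
  _ + X]mulr_natr divfK ?gt_eqF// in sum_le.
rewrite ler_pdivrMr//; apply: (le_trans sum_le).
rewrite mulrDl mulrAC divfK ?gt_eqF//; apply: lerD;
  first exact: le_trans warm_count _.
rewrite ler_peMr// lerDl divr_ge0// exprn_ge0// ltW//.
Qed.
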